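(* Local Thermal Operations and Classical Communication (LTOCC) form a strict subset of LTOCC with shared randomness (LTOCC+R). This holds for any number of rounds: for every $n\ge1$, $\mathrm{LTOCC}_n\subsetneq\mathrm{LTOCC}_n+\mathrm{R}$.
   Context: Alice and Bob hold finite-dimensional systems in energy-incoherent states, described by probability vectors. Their Gibbs vectors are $\gamma^{(A)},\gamma^{(B)}$ ($\gamma_i\propto e^{-\beta E_i}$ with the local inverse temperature and local energies). A local thermal operation is a (column-)stochastic matrix $\Lambda$ with $\Lambda\gamma=\gamma$ for the corresponding Gibbs vector. Indices $k,l$ denote Alice's and Bob's inputs, $i,j$ Alice's and Bob's outputs. A thermal tensor for Bob is $T^{(B)}_{jkl}\ge0$ with $\sum_jT^{(B)}_{jkl}=1$ for all $k,l$ and $\sum_lT^{(B)}_{jkl}\gamma^{(B)}_l=\gamma^{(B)}_j$ for all $j,k$. A thermal tensor for Alice is $T^{(A)}_{ikl}\ge0$ with $\sum_iT^{(A)}_{ikl}=1$ for all $k,l$ and $\sum_kT^{(A)}_{ikl}\gamma^{(A)}_k=\gamma^{(A)}_i$ for all $i,l$. A one-round LTOCC map is a stochastic matrix of the form $M_{ij,kl}=\Lambda^{(A)}_{ik}T^{(B)}_{jkl}$ or of the form $M_{ij,kl}=T^{(A)}_{ikl}\Lambda^{(B)}_{jl}$, with $\Lambda^{(A)},\Lambda^{(B)}$ local thermal operations of Alice and Bob and $T^{(A)},T^{(B)}$ thermal tensors for Alice and Bob. $\mathrm{LTOCC}_n$ (rounds without memory) is the set of matrix products of $n$ one-round LTOCC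 maps. With shared randomness (+R), Alice and Bob share a random variable taking value $\alpha$ with probability $\lambda_\alpha$ and perform a different LTOCC protocol depending on its value: $\mathrm{LTOCC}_n+\mathrm R$ is the set of convex combinations $M=\sum_\alpha\lambda_\alpha M^{(\alpha)}$ with $M^{(\alpha)}\in\mathrm{LTOCC}_n$, i.e. the convex hull of $\mathrm{LTOCC}_n$. *)

(* Defs.v *)
From mathcomp Require Import all_boot all_order all_algebra.
From mathcomp Require Import boolp classical_sets reals sequences exp.

Set Implicit Arguments.
Unset Strict Implicit.
Unset Printing Implicit Defensive.

Import Order.TTheory GRing.Theory Num.Theory.

Local Open Scope classical_set_scope.
Local Open Scope ring_scope.

(* Columns are inputs, rows are outputs: M i k = Pr(output i | input k). *)
Definition stochastic (R : realType) (m n : nat) (M : 'M[R]_(m, n)) : Prop :=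
  (forall i k, 0 <= M i k) /\ (forall k, \sum_i M i k = 1).

Definition gibbs (R : realType) (d : nat) (beta : R) (E : 'I_d -> R) :
    'cV[R]_d :=
  \col_i (expR (- (beta * E i)) / \sum_j expR (- (beta * E j))).

Definition thermal_op (R : realType) (d : nat) (g : 'cV[R]_d) :
    set 'M[R]_d :=
  [set L | stochastic L /\ L *m g = g].

(* T j k l : Bob's output j on Alice's input k and Bob's input l. *)
Definition thermal_tensor_Bob (R : realType) (dA dB : nat) (gB : 'cV[R]_dB)
    (T : 'I_dB -> 'I_dA -> 'I_dB -> R) : Prop :=
  [/\ forall j k l, 0 <= T j k l,
      forall k l, \sum_j T j k l = 1
    & forall j k, \sum_l T j k l * gB l 0 = gB j 0].

(* T i k l : Alice's output i on Alice's input k and Bob's input l. *)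
Definition thermal_tensor_Alice (R : realType) (dA dB : nat) (gA : 'cV[R]_dA)
    (T : 'I_dA -> 'I_dA -> 'I_dB -> R) : Prop :=
  [/\ forall i k l, 0 <= T i k l,
      forall k l, \sum_i T i k l = 1
    & forall i l, \sum_k T i k l * gA k 0 = gA i 0].

(* The pair (Alice's index i, Bob's index j) is encoded in 'I_(dA * dB) by
   mxvec_index i j, which is a bijection from 'I_dA * 'I_dB. *)
Definition one_round (R : realType) (dA dB : nat)
    (gA : 'cV[R]_dA) (gB : 'cV[R]_dB) : set 'M[R]_(dA * dB) :=
  [set M | stochastic M /\
    ((exists (L : 'M[R]_dA) (T : 'I_dB -> 'I_dA -> 'I_dB -> R),
        [/\ thermal_op gA L, thermal_tensor_Bob gB T
          & forall i j k l,
              M (mxvec_index i j) (mxvec_index k l) = L i k * T j k l])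
     \/
     (exists (T : 'I_dA -> 'I_dA -> 'I_dB -> R) (L : 'M[R]_dB),
        [/\ thermal_tensor_Alice gA T, thermal_op gB L
          & forall i j k l,
              M (mxvec_index i j) (mxvec_index k l) = T i k l * L j l]))].

Definition LTOCC (R : realType) (dA dB : nat)
    (gA : 'cV[R]_dA) (gB : 'cV[R]_dB) (n : nat) : set 'M[R]_(dA * dB) :=
  [set M | exists N : 'I_n -> 'M[R]_(dA * dB),
     (forall r, one_round gA gB (N r)) /\
     M = \big[mulmx/1%:M]_(r < n) N r].

(* The shared random variable takes finitely many values a : 'I_m. *)
Definition LTOCC_SR (R : realType) (dA dB : nat)
    (gA : 'cV[R]_dA) (gB : 'cV[R]_dB) (n : nat) : set 'M[R]_(dA * dB) :=
  [set M | exists (m : nat) (lambda : 'I_m -> R)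
                  (N : 'I_m -> 'M[R]_(dA * dB)),
     [/\ forall a, 0 <= lambda a,
         \sum_a lambda a = 1,
         forall a, LTOCC gA gB n (N a)
       & M = \sum_a lambda a *: N a]].

(* Main.v *)
(** Work with matrices close to the identity whose support, besides the diagonal,
    is a bidirectional star on the cross {(k0, l)} u {(k, l0)} centred at the
    state o = (k0, l0) of least Gibbs weight.  Such a matrix M is the even
    mixture of a Bob operation controlled by "Alice is in k0" and an Alice
    operation controlled by "Bob is in l0".

    Stars are prime: if M = B C with B, C stochastic and Gibbs-preserving, the
    dominant diagonal of M yields a permutation after which B and C have
    positive diagonals, hence supports inside the star.  As M has no entry
    between two distinct leaves, either C has no flow into o, or B has no flow out
    of o, or both flows use one single leaf.  In the first two cases minimality
    of the weight of o forces C, resp. B, to be a permutation; the third one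
    fixes the remaining rates M o b to be 1 - g b / g y for some state y, which is
    avoided by making the rates small.  So if M is a product of one-round maps,
    some factor is M up to permutations of rows and columns.

    But the columns of a one-round map have supports of product form.  The centre
    column has dA + dB - 1 > max dA dB nonzero entries, so its support is a
    rectangle with at least two rows and two columns of the dA x dB grid, and this contradicts the two-element
    supports of the leaf columns. *)

Require Import Defs.
From mathcomp Require Import all_boot all_order all_algebra all_fingroup.
From mathcomp Require Import boolp classical_sets reals sequences exp.
From mathcomp Require Import zify ring lra.

Set Implicit Arguments.
Unset Strict Implicit.
Unset Printing Implicit Defensive.

Import Order.TTheory GRing.Theory Num.Theory.

Local Open Scope classical_set_scope.
Local Open Scope ring_scope.

(** * Products of stochastic and Gibbs-preserving matrices *)

Lemma mulmx_term_le (R : realType) (d : nat) (B C : 'M[R]_d)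
    (hB : stochastic B) (hC : stochastic C) (x y z : 'I_d) :
  B x y * C y z <= (B *m C) x z.
Proof.
case: hB hC => hB _ [hC _]; rewrite mxE (bigD1 y) //= lerDl.
by apply: sumr_ge0 => w _; apply: mulr_ge0.
Qed.

Lemma stochastic1 (R : realType) (d : nat) : stochastic (1%:M : 'M[R]_d).
Proof.
split=> [i k|k]; first by rewrite mxE ler0n.
rewrite (bigD1 k) //= mxE eqxx big1 ?addr0 // => i /negbTE nik.
by rewrite mxE nik.
Qed.

Lemma stochasticM (R : realType) (d : nat) (B C : 'M[R]_d) :
  stochastic B -> stochastic C -> stochastic (B *m C).
Proof.
move=> [hB sB] [hC sC]; split=> [i k|k].
  by rewrite mxE; apply: sumr_ge0 => j _; apply: mulr_ge0.
under eq_bigr do rewrite mxE.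
rewrite exchange_big /= -[RHS](sC k).
by apply: eq_bigr => j _; rewrite -mulr_suml sB mul1r.
Qed.

Lemma thermal_op1 (R : realType) (d : nat) (g : 'cV[R]_d) :
  thermal_op g 1%:M.
Proof. by split; [exact: stochastic1 | rewrite mul1mx]. Qed.

Lemma thermal_opM (R : realType) (d : nat) (g : 'cV[R]_d) (B C : 'M[R]_d) :
  thermal_op g B -> thermal_op g C -> thermal_op g (B *m C).
Proof.
move=> [hB gB] [hC gC]; split; first exact: stochasticM.
by rewrite -mulmxA gC gB.
Qed.

Lemma stochastic_diag1 (R : realType) (d : nat) (S : 'M[R]_d) (x y : 'I_d) :
  stochastic S -> 1 <= S y y -> x != y -> S x y = 0.
Proof.
move=> [hS sS] Syy nxy; apply/eqP; rewrite eq_le hS andbT.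
move: (sS y); rewrite (bigD1 y) //= (bigD1 x) //=.
have : 0 <= \sum_(i | (i != y) && (i != x)) S i y by apply: sumr_ge0.
lra.
Qed.

Lemma stochastic_offdiag0 (R : realType) (d : nat) (S : 'M[R]_d) (y : 'I_d) :
  stochastic S -> (forall x, x != y -> S x y = 0) -> S y y = 1.
Proof.
by move=> [_ sS] h; rewrite -(sS y) (bigD1 y) //= big1 ?addr0.
Qed.

Lemma stochastic_eq1 (R : realType) (d : nat) (S : 'M[R]_d) :
  stochastic S -> (forall x y, x != y -> ~~ (0 < S x y)) -> S = 1%:M.
Proof.
move=> hS h.
have h0 x y : x != y -> S x y = 0.
  move=> /h; rewrite lt0r hS.1 andbT negbK; exact/eqP.
apply/matrixP=> x y; rewrite mxE.
case: (eqVneq x y) => [->|/h0 -> //].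
by apply: stochastic_offdiag0 => // z /h0.
Qed.

(* Each y has at most one x with B x y > 1/2, so choosing for every x some y
   with B x y > 1/2 and C y x > 0 is injective. *)
Lemma mulmx_diag_perm (R : realType) (d : nat) (B C : 'M[R]_d) :
  stochastic B -> stochastic C -> (forall x, 1 / 2 < (B *m C) x x) ->
  exists s : 'S_d, forall x, 0 < B x (s x) /\ 0 < C (s x) x.
Proof.
move=> hB hC hd.
have ex x : exists y, (1 / 2 < B x y) && (0 < C y x).
  apply/existsP; apply: contraT; rewrite negb_exists => /forallP h.
  (* Without such a [y], each term of the diagonal entry is at most [C y x / 2], and column [x] of
     [C] sums to 1. *)
  suff : (B *m C) x x <= 1 / 2 by rewrite leNgt hd.
  have -> : 1 / 2 = 1 / 2 * \sum_y C y x by rewrite hC.2 mulr1.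
  rewrite mxE mulr_sumr.
  apply: ler_sum => y _; move: (h y); rewrite negb_and -!leNgt.
  case/orP => [Bh|C0]; first by rewrite ler_wpM2r // hC.1.
  have -> : C y x = 0 by apply/eqP; rewrite eq_le C0 hC.1.
  by rewrite !mulr0.
pose f x := xchoose (ex x).
have fP x : (1 / 2 < B x (f x)) && (0 < C (f x) x) by exact: xchooseP (ex x).
have inj_f : injective f.
  move=> x y exy; apply: contraTeq isT => nxy.
  have /andP[Bx _] := fP x; have /andP[By _] := fP y.
  rewrite -exy in By; move: (hB.2 (f x)).
  rewrite (bigD1 x) //= (bigD1 y) 1?eq_sym //=.
  have : 0 <= \sum_(i | (i != x) && (i != y)) B i (f x).
    by apply: sumr_ge0 => i _; exact: hB.1.
  lra.
exists (perm inj_f) => x; rewrite permE; case/andP: (fP x) => Bx ->; split=> //.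
by apply: lt_trans Bx; lra.
Qed.

(** * Stars and their factorizations *)

(** The bound 1/2 on the diagonal feeds [mulmx_diag_perm]. Two leaves guarantee that one is left
    over when a single leaf carries both flows through [o]. *)
Definition star (R : realType) (d : nat) (o : 'I_d) (leaf : {set 'I_d})
    (M : 'M[R]_d) : Prop :=
  [/\ o \notin leaf, (1 < #|leaf|)%N, forall x, 1 / 2 < M x x &
      forall x y, (0 < M x y) =
        [|| x == y, (x == o) && (y \in leaf) | (y == o) && (x \in leaf)]].

(* g' is the image of g under the permutation that makes both diagonals positive. *)
Lemma star_factor_normalized (R : realType) (d : nat) (o : 'I_d)
    (leaf : {set 'I_d}) (g g' : 'cV[R]_d) (B C : 'M[R]_d) :
  star o leaf (B *m C) -> stochastic B -> stochastic C ->
  (forall x, 0 < B x x) -> (forall x, 0 < C x x) ->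
  C *m g = g' -> B *m g' = g ->
  (forall y, 0 < g y 0) -> (forall y, 0 < g' y 0) -> g o 0 <= g' o 0 ->
  (forall b, b \in leaf -> (B *m C) o b * g' b 0 != g' b 0 - g b 0) ->
  B = 1%:M \/ C = 1%:M.
Proof.
move=> [nol card_leaf _ supp] hB hC dB dC Cg Bg g_gt0 g'_gt0 go res.
(* Positive diagonals put the supports of both factors inside the support of the product. *)
have suppB x y : 0 < B x y -> 0 < (B *m C) x y.
  by move=> Bxy; apply: lt_le_trans (mulmx_term_le _ _ _ y _) => //; apply: mulr_gt0.
have suppC x y : 0 < C x y -> 0 < (B *m C) x y.
  by move=> Cxy; apply: lt_le_trans (mulmx_term_le _ _ _ x _) => //; apply: mulr_gt0.
have notpos (S : 'M[R]_d) x y : stochastic S -> ~~ (0 < S x y) -> S x y = 0.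
  by move=> hS; rewrite lt0r hS.1 andbT negbK => /eqP.
have rowg (S : 'M[R]_d) (u : 'cV[R]_d) x : (forall y, x != y -> S x y = 0) ->
    (S *m u) x 0 = S x x * u x 0.
  move=> S0; rewrite mxE (bigD1 x) //= big1 ?addr0 // => y; rewrite eq_sym => /S0 ->.
  by rewrite mul0r.
case: (pselect (exists2 x, x \in leaf & 0 < C o x)) => [[v vl Cov]|V0]; last first.
  right; have Co x : o != x -> C o x = 0.
    move=> nox; apply: notpos => //; apply/negP => Cox.
    move: (suppC _ _ Cox); rewrite supp (negbTE nox) eqxx (negbTE nol) andbF orbF /=.
    by move=> xl; apply: V0; exists x.
  (* Row [o] of [C] is now diagonal, so [g' o = C o o * g o]. As [g o <= g' o], column [o] of [C]
     must be a unit vector too. *)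
  have Coo : 1 <= C o o.
    move: go; rewrite -Cg rowg // -{1}[g o 0]mul1r ler_pM2r //.
  apply: stochastic_eq1 => // x y nxy; apply/negP => Cxy.
  move: (suppC _ _ Cxy); rewrite supp (negbTE nxy) /= => /orP[] /andP[/eqP eo _].
    by move: Cxy nxy; rewrite eo => /[swap] /Co ->; rewrite ltxx.
  by move: Cxy; rewrite eo stochastic_diag1 ?ltxx // -eo.
case: (pselect (exists2 x, x \in leaf & 0 < B x o)) => [[u ul Buo]|U0]; last first.
  left; have Bo x : x != o -> B x o = 0.
    move=> nxo; apply: notpos => //; apply/negP => Bxo.
    move: (suppB _ _ Bxo); rewrite supp (negbTE nxo) eqxx /= => xl.
    by apply: U0; exists x.
  have Boo : B o o = 1 by apply: stochastic_offdiag0.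
  apply: stochastic_eq1 => // x y nxy; apply/negP => Bxy.
  move: (suppB _ _ Bxy); rewrite supp (negbTE nxy) /= => /orP[] /andP[/eqP eo _]; last first.
    by move: Bxy; rewrite eo Bo ?ltxx // -eo.
  (* An entry [B o y > 0] would give [g o >= g' o + B o y * g' y > g' o]. *)
  subst x; move: go; rewrite -Bg mxE (bigD1 o) //= (bigD1 y) 1?eq_sym //= Boo mul1r.
  have : 0 <= \sum_(i | (i != o) && (i != y)) B o i * g' i 0.
    by apply: sumr_ge0 => i _; apply: mulr_ge0; [exact: hB.1 | exact: ltW].
  have := mulr_gt0 Bxy (g'_gt0 y).
  lra.
have leaf_o x : x \in leaf -> x != o by apply: contraTneq => ->.
(* A path from [y] through [o] to [x] would create an entry of the product between two leaves. *)
have clash x y : x \in leaf -> y \in leaf -> 0 < B x o -> 0 < C o y -> x = y.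
  move=> xl yl Bxo Coy; apply/eqP.
  have : 0 < (B *m C) x y.
    by apply: lt_le_trans (mulmx_term_le _ _ _ o _) => //; apply: mulr_gt0.
  by rewrite supp (negbTE (leaf_o _ xl)) (negbTE (leaf_o _ yl)) !orbF.
have euv := clash _ _ ul vl Buo Cov; subst v.
have [b bl nbu] : exists2 b, b \in leaf & b != u.
  move: card_leaf; rewrite (cardD1 u) ul add1n ltnS => /card_gt0P[b].
  by rewrite !inE => /andP[nb bl]; exists b.
(* For the spare leaf [b], row [b] of [B] and column [b] of [C] are diagonal, and column [b] of [B]
   lives on [b] and [o]. Hence [g b = (1 - B o b) * g' b] with [B o b = (B *m C) o b], the equality
   that [res] excludes. *)
exfalso; move: (res b bl); apply/negP; rewrite negbK; apply/eqP.
have nbo := leaf_o _ bl.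
have Bb y : b != y -> B b y = 0.
  move=> nby; apply: notpos => //; apply/negP => Bby.
  move: (suppB _ _ Bby); rewrite supp (negbTE nby) (negbTE nbo) bl andbT /=.
  move=> /eqP yo; subst y.
  by move: nbu; rewrite (clash b u) ?eqxx.
have Cb y : y != b -> C y b = 0.
  move=> nyb; apply: notpos => //; apply/negP => Cyb.
  move: (suppC _ _ Cyb); rewrite supp (negbTE nyb) (negbTE nbo) bl andbT orbF /=.
  move=> /eqP yo; subst y.
  by move: nbu; rewrite -(clash u b) ?eqxx.
have Bcolb x : x != b -> x != o -> B x b = 0.
  move=> nxb nxo; apply: notpos => //; apply/negP => /suppB.
  by rewrite supp (negbTE nxb) (negbTE nxo) (negbTE nbo).
have -> : (B *m C) o b = B o b.
  rewrite mxE (bigD1 b) //= (stochastic_offdiag0 hC Cb).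
  by rewrite mulr1 big1 ?addr0 // => y /Cb ->; rewrite mulr0.
have -> : g b 0 = B b b * g' b 0 by rewrite -{1}Bg rowg.
have <- : 1 - B o b = B b b.
  rewrite -(hB.2 b) (bigD1 b) //= (bigD1 o) 1?eq_sym //= big1 ?addr0 ?addrK //.
  by move=> x /andP[xb xo]; apply: Bcolb.
by ring.
Qed.

Lemma stochastic_perm_mx (R : realType) (d : nat) (s : 'S_d) :
  stochastic (perm_mx s : 'M[R]_d).
Proof.
split=> [i k|k]; first by rewrite !mxE ler0n.
rewrite (bigD1 (s^-1 k)%g) //= big1 => [|i]; rewrite !mxE.
  by rewrite permKV eqxx addr0.
by rewrite -(inj_eq (@perm_inj _ s)) permKV => /negbTE ->.
Qed.

Lemma mul_perm_mxV (R : realType) (d : nat) (s : 'S_d) :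
  (perm_mx s *m perm_mx s^-1 = 1%:M :> 'M[R]_d) /\
  (perm_mx s^-1 *m perm_mx s = 1%:M :> 'M[R]_d).
Proof.
by split; rewrite -perm_mxM; [rewrite mulgV | rewrite mulVg]; rewrite perm_mx1.
Qed.

(** Inserting [perm_mx s^-1 *m perm_mx s] between the factors makes both diagonals positive and
    replaces the middle vector by the permuted [g]. Since [s] is unknown, [res] must cover every
    state [y]. *)
Lemma star_factor (R : realType) (d : nat) (o : 'I_d) (leaf : {set 'I_d})
    (g : 'cV[R]_d) (B C : 'M[R]_d) :
  star o leaf (B *m C) -> thermal_op g B -> thermal_op g C ->
  (forall y, 0 < g y 0) -> (forall y, g o 0 <= g y 0) ->
  (forall b y, b \in leaf -> (B *m C) o b * g y 0 != g y 0 - g b 0) ->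
  (exists s, B = perm_mx s) \/ (exists s, C = perm_mx s).
Proof.
move=> hstar [hB Bg] [hC Cg] g_gt0 go res.
have [_ _ diag _] := hstar.
have [s sP] := mulmx_diag_perm hB hC diag.
have [sV Vs] := mul_perm_mxV R s.
have BC : (B *m perm_mx s^-1) *m (perm_mx s *m C) = B *m C.
  by rewrite -mulmxA (mulmxA (perm_mx _)) Vs mul1mx.
have col x y : (B *m perm_mx s^-1) x y = B x (s y) by rewrite -col_permE mxE.
have row m (A : 'M[R]_(d, m)) x y : (perm_mx s *m A) x y = A (s x) y.
  by rewrite -row_permE mxE.
have [] := @star_factor_normalized R d o leaf g (perm_mx s *m g)
  (B *m perm_mx s^-1) (perm_mx s *m C).
- by rewrite BC.
- by apply: stochasticM => //; exact: stochastic_perm_mx.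
- by apply: stochasticM => //; exact: stochastic_perm_mx.
- by move=> x; rewrite col; case: (sP x).
- by move=> x; rewrite row; case: (sP x).
- by rewrite -mulmxA Cg.
- by rewrite -mulmxA (mulmxA (perm_mx _)) Vs mul1mx.
- exact: g_gt0.
- by move=> y; rewrite row.
- by rewrite row.
- by move=> b bl; rewrite BC row res.
- by move=> B1; left; exists s; rewrite -[B]mulmx1 -Vs mulmxA B1 mul1mx.
- by move=> C1; right; exists s^-1%g; rewrite -[C]mul1mx -Vs -mulmxA C1 mulmx1.
Qed.

Lemma star_not_perm_mx (R : realType) (d : nat) (o : 'I_d) (leaf : {set 'I_d})
    (s : 'S_d) : ~ star o leaf (perm_mx s : 'M[R]_d).
Proof.
move=> [nol /ltnW/card_gt0P[b bl] _ supp].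
have pos x y : 0 < (perm_mx s : 'M[R]_d) x y -> s x = y.
  by rewrite !mxE ltr0n lt0b => /eqP.
have so : s o = o by apply: pos; rewrite supp eqxx.
have sb : s b = o by apply: pos; rewrite supp eqxx bl !orbT.
by move: nol; rewrite -(perm_inj (etrans sb (esym so))) bl.
Qed.

(* The prefix perm_mx p absorbs the factors that turn out to be permutations. *)
Lemma star_factor_prod (R : realType) (d : nat) (o : 'I_d) (leaf : {set 'I_d})
    (g : 'cV[R]_d) (M : 'M[R]_d) (s : seq 'M[R]_d) (p : 'S_d) :
  star o leaf M -> (forall y, 0 < g y 0) -> (forall y, g o 0 <= g y 0) ->
  (forall b y, b \in leaf -> M o b * g y 0 != g y 0 - g b 0) ->
  (forall N, N \in s -> thermal_op g N) -> thermal_op g (perm_mx p) ->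
  M = perm_mx p *m \big[mulmx/1%:M]_(N <- s) N ->
  exists (N : 'M[R]_d) (t u : 'S_d),
    N \in s /\ N = perm_mx t *m M *m perm_mx u.
Proof.
move=> hM g_gt0 go res; elim: s p => [|N s IH] p hs hp.
  by rewrite big_nil mulmx1 => Mp; case: (@star_not_perm_mx R d o leaf p); rewrite -Mp.
rewrite big_cons mulmxA => MBC.
have hs' N' : N' \in s -> thermal_op g N' by move=> ?; apply: hs; rewrite inE orbC; apply/orP; left.
have hB : thermal_op g (perm_mx p *m N).
  by apply: thermal_opM => //; apply: hs; rewrite mem_head.
have hC : thermal_op g (\big[mulmx/1%:M]_(N <- s) N).
  rewrite big_seq; apply: (big_ind (fun X => thermal_op g X)) => //.
    exact: thermal_op1.
  by move=> ? ?; exact: thermal_opM.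
(* Either the prefix times [N] is a permutation and becomes the new prefix, or the tail is one and
   [N] is [M] up to permutations. *)
case: (star_factor (o := o) (leaf := leaf) (g := g) _ hB hC) => //.
- by rewrite -MBC.
- by rewrite -MBC.
- move=> [t Bt]; rewrite Bt in MBC hB.
  have [N' [t' [u' [N's N'E]]]] := IH t hs' hB MBC.
  by exists N', t', u'; rewrite inE N's orbT.
- move=> [t Ct]; exists N, (p^-1)%g, (t^-1)%g; rewrite mem_head; split=> //.
  have [tV _] := mul_perm_mxV R t; have [_ Vp] := mul_perm_mxV R p.
  by rewrite MBC Ct !mulmxA Vp mul1mx -mulmxA tV mulmx1.
Qed.

(** * Supports of one-round maps *)

Lemma mxvec_index_inj (m n : nat) (i i' : 'I_m) (j j' : 'I_n) :
  (mxvec_index i j == mxvec_index i' j') = (i == i') && (j == j').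
Proof.
by rewrite /mxvec_index (inj_eq (@cast_ord_inj _ _ _)) (inj_eq enum_rank_inj).
Qed.

Lemma sum_mxvec_index (R : realType) (m n : nat) (F : 'I_(m * n) -> R) :
  \sum_x F x = \sum_i \sum_j F (mxvec_index i j).
Proof.
rewrite pair_bigA (reindex _ (curry_mxvec_bij m n)) /=.
by apply: eq_bigr => -[i j].
Qed.

(** For a fixed input [(k, l)] the entry is a factor in [i] times a factor in [j], so positivity can
    be tested on each factor separately. *)
Lemma one_round_rectangle (R : realType) (dA dB : nat) (gA : 'cV[R]_dA)
    (gB : 'cV[R]_dB) (N : 'M[R]_(dA * dB)) (i i' : 'I_dA) (j j' : 'I_dB)
    (y : 'I_(dA * dB)) :
  one_round gA gB N -> 0 < N (mxvec_index i j) y ->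
  0 < N (mxvec_index i' j') y -> 0 < N (mxvec_index i j') y.
Proof.
case/mxvec_indexP: y => k l [_].
have key (a b a' b' : R) : 0 <= a -> 0 <= b -> 0 <= a' -> 0 <= b' ->
    0 < a * b -> 0 < a' * b' -> 0 < a * b'.
  move=> a0 b0 a'0 b'0; rewrite !lt0r !mulf_eq0 !negb_or !mulr_ge0 // !andbT.
  by move=> /andP[-> _] /andP[_ ->].
case=> [[L [T [[[L0 _] _] [T0 _ _] E]]]|[T [L [[T0 _ _] [[L0 _] _] E]]]].
  by rewrite !E; apply: key.
by rewrite !E; apply: key.
Qed.

Lemma one_round_not_star (R : realType) (dA dB : nat) (gA : 'cV[R]_dA)
    (gB : 'cV[R]_dB) (o : 'I_(dA * dB)) (leaf : {set 'I_(dA * dB)})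
    (M : 'M[R]_(dA * dB)) (t u : 'S_(dA * dB)) :
  star o leaf M -> (dA <= #|leaf|)%N -> (dB <= #|leaf|)%N ->
  ~ one_round gA gB (perm_mx t *m M *m perm_mx u).
Proof.
move=> [nol _ _ supp] cA cB hN.
set N := perm_mx t *m M *m perm_mx u in hN.
have NE x z : N x (u z) = M (t x) z.
  by rewrite /N -[u]invgK -col_permE -row_permE !mxE invgK permK.
have tinj x y : (t x == t y) = (x == y) by apply: inj_eq; exact: perm_inj.
have colo x : (0 < N x (u o)) = (t x == o) || (t x \in leaf).
  by rewrite NE supp eqxx (negbTE nol) andbF /=.
have coll x z : t z \in leaf -> (0 < N x (u (t z))) = (t x == o) || (x == z).
  move=> zl; rewrite NE supp zl andbT tinj.
  have -> : (t z == o) = false by apply: contraNF nol => /eqP <-.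
  by rewrite orbF orbC.
have [r0 tr0] : exists r0, t r0 = o by exists (t^-1 o)%g; rewrite permKV.
case/mxvec_indexP: r0 tr0 => i0 j0 tr0.
(* The support of a leaf column is the centre and that leaf. If they differed in both coordinates,
   the rectangle would contain a third point. *)
have cross i j : t (mxvec_index i j) \in leaf -> (i == i0) || (j == j0).
  move=> ijl; apply: contraT; rewrite negb_or => /andP[ni nj].
  have : 0 < N (mxvec_index i0 j) (u (t (mxvec_index i j))).
    by apply: (one_round_rectangle (j := j0) (i' := i) hN); rewrite coll // ?tr0 eqxx ?orbT.
  rewrite coll // -tr0 tinj !mxvec_index_inj !eqxx /= (negbTE nj) andbT.
  by rewrite eq_sym (negbTE ni).
(* The centre and the leaves number more than [d], so they do not fit on one line [f] of the
   grid. *)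
have outside (d : nat) (f : 'I_d -> 'I_(dA * dB)) : (d <= #|leaf|)%N ->
    (exists x, t (f x) = o) -> exists2 z, t z \in leaf & forall x, z != f x.
  move=> hd [x0 fx0]; apply: contrapT => hno.
  have sub : o |: leaf \subset imset (t \o f) (mem 'I_d).
    apply/fintype.subsetP => y; rewrite !inE => /orP[/eqP->|yl].
      by rewrite -fx0; apply/imsetP; exists x0.
    apply: contraT => /imsetP hy; case: hno; exists (t^-1 y)%g; rewrite ?permKV //.
    by move=> x; apply: contra_notN hy => /eqP yx; exists x; rewrite //= -yx permKV.
  move: (leq_trans (subset_leq_card sub) (leq_imset_card _ _)).
  by rewrite cardsU1 nol add1n card_ord ltnNge hd.
have [z1 z1l z1P] := outside _ (fun j => mxvec_index i0 j) cB (ex_intro _ j0 tr0).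
have [z2 z2l z2P] := outside _ (fun i => mxvec_index i j0) cA (ex_intro _ i0 tr0).
case/mxvec_indexP: z1 z1l z1P => i1 j1 l1 /(_ j1).
case/mxvec_indexP: z2 z2l z2P => i2 j2 l2 /(_ i2).
rewrite !mxvec_index_inj !eqxx /= andbT => nj ni.
have := cross _ _ l1; rewrite (negbTE ni) /= => /eqP j10; subst j1.
have := cross _ _ l2; rewrite (negbTE nj) orbF => /eqP i20; subst i2.
(* The column of the centre contains [(i1, j0)] and [(i0, j2)], hence also the corner [(i1, j2)],
   which lies off the cross. *)
have : 0 < N (mxvec_index i1 j2) (u o).
  by apply: (one_round_rectangle (i' := i0) (j := j0) hN); rewrite colo ?l1 ?l2 orbT.
rewrite colo -tr0 tinj mxvec_index_inj (negbTE ni) /= => /cross.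
by rewrite (negbTE ni) (negbTE nj).
Qed.

(** * Local thermal operations supported on a star *)

(** This is a lazy reversible random walk on the star centred at [l0]. Minimality of [g l0] keeps
    the rates below [eps], and [d * eps < 1/2] keeps the walk lazy. *)
Lemma star_thermal_op (R : realType) (d : nat) (g : 'cV[R]_d) (l0 : 'I_d)
    (eps : R) :
  (forall l, 0 < g l 0) -> (forall l, g l0 0 <= g l 0) ->
  0 < eps -> d%:R * eps < 1 / 2 ->
  exists S : 'M[R]_d, [/\ thermal_op g S, forall l, 1 / 2 < S l l,
    forall j l, j != l -> S j l <= eps &
    forall j l, (0 < S j l) = [|| j == l, j == l0 | l == l0]].
Proof.
move=> g_gt0 g_min eps0 deps.
(* w j l * g l is symmetric in j and l, hence detailed balance. *)
pose w j l : R := ((j != l) && ((j == l0) || (l == l0)))%:R * (eps * g l0 0 / g l 0).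
have w_le j l : 0 <= w j l <= eps.
  have h : 0 < eps * g l0 0 / g l 0 <= eps.
    by rewrite divr_gt0 ?mulr_gt0 //= ler_pdivrMr // ler_pM2l.
  by rewrite /w; case: ((j != l) && _); rewrite ?mul1r ?mul0r; lra.
have w_sum l : 0 <= \sum_i w i l < 1 / 2.
  rewrite sumr_ge0 /=; last by move=> i _; case/andP: (w_le i l).
  apply: le_lt_trans deps.
  have <- : \sum_(i < d) eps = d%:R * eps by rewrite sumr_const card_ord mulr_natl.
  apply: ler_sum => i _.
  by case/andP: (w_le i l).
pose S := \matrix_(j, l) (w j l + (j == l)%:R * (1 - \sum_i w i l)).
have S_off j l : j != l -> S j l = w j l.
  by move=> /negbTE h; rewrite mxE h mul0r addr0.
have S_diag l : S l l = 1 - \sum_i w i l.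
  by rewrite mxE eqxx mul1r /w eqxx /= mul0r add0r.
have half l : 1 / 2 < S l l by rewrite S_diag; have := w_sum l; lra.
have dsum (F : 'I_d -> R) l : \sum_i (i == l)%:R * F i = F l.
  rewrite (bigD1 l) //= eqxx mul1r big1 ?addr0 // => i /negbTE ->.
  by rewrite mul0r.
exists S; split=> // [|j l njl|j l].
- split; first split.
  + move=> j l; case: (eqVneq j l) => [->|njl].
      by apply: ltW; apply: lt_trans (half l); lra.
    by rewrite S_off //; case/andP: (w_le j l).
  + move=> l; under eq_bigr do rewrite mxE.
    by rewrite big_split /= (dsum (fun=> _)); ring.
  + apply/matrixP => j k; rewrite ord1 mxE.
    have SE l : S j l * g l 0 =
        w j l * g l 0 + (l == j)%:R * ((1 - \sum_i w i l) * g l 0).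
      by rewrite [S j l]mxE (eq_sym l) mulrDl -[X in _ + X]mulrA.
    under eq_bigr do rewrite SE.
    rewrite big_split /= (dsum (fun l => (1 - \sum_i w i l) * g l 0)).
    rewrite mulrBl mul1r mulr_suml addrCA -sumrB big1 ?addr0 // => l _.
    have gn0 i : g i 0 != 0 by rewrite gt_eqF.
    rewrite /w eq_sym orbC -!mulrA !mulVf // subrr //.
- by rewrite S_off //; case/andP: (w_le j l).
- case: (eqVneq j l) => [->|njl] /=; first by apply: lt_trans (half l); lra.
  rewrite S_off // /w njl /=; case: (_ || _); last by rewrite mul0r ltxx.
  by rewrite mul1r divr_gt0 ?mulr_gt0.
Qed.

Lemma exists_lower_bound (R : realType) (T : finType) (F : T -> R) :
  exists2 delta : R, 0 < delta & forall t, 0 < F t -> delta <= F t.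
Proof.
(* The default 1 keeps the bound positive when no value of [F] is. *)
exists (\big[Order.min/1]_(t | 0 < F t) F t).
  by apply: (big_ind (fun x => 0 < x)) => // x y x0 y0; rewrite lt_min x0.
by move=> t Ft; rewrite (bigD1 t) //= ge_min lexx.
Qed.

Lemma exists_argmin (R : realType) (d : nat) (g : 'cV[R]_d) : (0 < d)%N ->
  exists l0, forall l, g l0 0 <= g l 0.
Proof.
move=> hd; case: (arg_minP (i0 := Ordinal hd) (P := predT) (fun l => g l 0)) => //.
by move=> l0 _ h; exists l0 => l; apply: h.
Qed.

Lemma gibbs_gt0 (R : realType) (d : nat) (beta : R) (E : 'I_d -> R) (i : 'I_d) :
  0 < gibbs beta E i 0.
Proof.
rewrite mxE divr_gt0 ?expR_gt0 // (bigD1 i) //= ltr_wpDr ?expR_gt0 //.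
by apply: sumr_ge0 => j _; apply: expR_ge0.
Qed.

Lemma exists_mxvec_matrix (R : realType) (m n : nat)
    (F : 'I_m -> 'I_n -> 'I_m -> 'I_n -> R) :
  exists M : 'M[R]_(m * n), forall i j k l,
    M (mxvec_index i j) (mxvec_index k l) = F i j k l.
Proof.
have [h hK _] := curry_mxvec_bij m n.
exists (\matrix_(x, y) F (h x).1 (h x).2 (h y).1 (h y).2) => i j k l.
have hE a b : h (mxvec_index a b) = (a, b) by exact: (hK (a, b)).
by rewrite mxE !hE.
Qed.

(** * The joint Gibbs vector, controlled operations and mixtures *)

Definition joint_gibbs (R : realType) (dA dB : nat) (gA : 'cV[R]_dA)
    (gB : 'cV[R]_dB) : 'cV[R]_(dA * dB) :=
  (mxvec (\matrix_(k, l) (gA k 0 * gB l 0)))^T.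

Lemma joint_gibbsE (R : realType) (dA dB : nat) (gA : 'cV[R]_dA)
    (gB : 'cV[R]_dB) k l :
  joint_gibbs gA gB (mxvec_index k l) 0 = gA k 0 * gB l 0.
Proof. by rewrite mxE mxvecE mxE. Qed.

(** For each input of the sender, the tensor preserves the receiver's Gibbs vector; the sender's
    local operation then preserves the other one. *)
Lemma one_round_thermal (R : realType) (dA dB : nat) (gA : 'cV[R]_dA)
    (gB : 'cV[R]_dB) (N : 'M[R]_(dA * dB)) :
  one_round gA gB N -> thermal_op (joint_gibbs gA gB) N.
Proof.
move=> [sN hN]; split=> //; apply/matrixP => x z; rewrite ord1 {z}.
case/mxvec_indexP: x => i j; rewrite mxE sum_mxvec_index joint_gibbsE.
have rowE (d : nat) (L : 'M[R]_d) (g : 'cV[R]_d) a : L *m g = g -> \sum_b L a b * g b 0 = g a 0.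
  by move=> {2}<-; rewrite mxE.
case: hN => [[L [T [[_ LgA] [_ _ Tg] E]]]|[T [L [[_ _ Tg] [_ LgB] E]]]].
  rewrite -(rowE _ _ _ _ LgA) mulr_suml; apply: eq_bigr => k _.
  rewrite -(Tg j k) mulr_sumr; apply: eq_bigr => l _.
  by rewrite E joint_gibbsE mulrACA.
rewrite exchange_big /= -(rowE _ _ _ _ LgB) mulr_sumr; apply: eq_bigr => l _.
rewrite -(Tg i l) mulr_suml; apply: eq_bigr => k _.
by rewrite E joint_gibbsE mulrACA.
Qed.

Lemma thermal_op_tensor_Bob (R : realType) (dA dB : nat) (gB : 'cV[R]_dB)
    (S : 'I_dA -> 'M[R]_dB) : (forall k, thermal_op gB (S k)) ->
  thermal_tensor_Bob gB (fun j k l => S k j l).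
Proof.
move=> hS; split=> [j k l|k l|j k]; have [[S0 S1] Sg] := hS k; [exact: S0|exact: S1|].
by rewrite -{2}Sg mxE.
Qed.

Lemma thermal_op_tensor_Alice (R : realType) (dA dB : nat) (gA : 'cV[R]_dA)
    (S : 'I_dB -> 'M[R]_dA) : (forall l, thermal_op gA (S l)) ->
  thermal_tensor_Alice gA (fun i k l => S l i k).
Proof.
move=> hS; split=> [i k l|k l|i l]; have [[S0 S1] Sg] := hS l; [exact: S0|exact: S1|].
by rewrite -{2}Sg mxE.
Qed.

Lemma one_round_Bob (R : realType) (dA dB : nat) (gA : 'cV[R]_dA)
    (gB : 'cV[R]_dB) (S : 'I_dA -> 'M[R]_dB) (N : 'M[R]_(dA * dB)) :
  (forall k, thermal_op gB (S k)) ->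
  (forall i j k l, N (mxvec_index i j) (mxvec_index k l) = (i == k)%:R * S k j l) ->
  one_round gA gB N.
Proof.
move=> hS NE; split; last first.
  left; exists 1%:M, (fun j k l => S k j l).
  split; [exact: thermal_op1 | exact: thermal_op_tensor_Bob |].
  by move=> i j k l; rewrite NE mxE.
split=> [x y|y].
  case/mxvec_indexP: x => i j; case/mxvec_indexP: y => k l.
  by rewrite NE mulr_ge0 ?ler0n //; case: (hS k) => -[].
case/mxvec_indexP: y => k l; rewrite sum_mxvec_index (bigD1 k) //= [X in _ + X]big1 ?addr0.
  under eq_bigr do rewrite NE eqxx mul1r.
  by case: (hS k) => -[].
by move=> i /negbTE nik; apply: big1 => j _; rewrite NE nik mul0r.
Qed.

Lemma one_round_Alice (R : realType) (dA dB : nat) (gA : 'cV[R]_dA)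
    (gB : 'cV[R]_dB) (S : 'I_dB -> 'M[R]_dA) (N : 'M[R]_(dA * dB)) :
  (forall l, thermal_op gA (S l)) ->
  (forall i j k l, N (mxvec_index i j) (mxvec_index k l) = S l i k * (j == l)%:R) ->
  one_round gA gB N.
Proof.
move=> hS NE; split; last first.
  right; exists (fun i k l => S l i k), 1%:M.
  split; [exact: thermal_op_tensor_Alice | exact: thermal_op1 |].
  by move=> i j k l; rewrite NE mxE.
split=> [x y|y].
  case/mxvec_indexP: x => i j; case/mxvec_indexP: y => k l.
  by rewrite NE mulr_ge0 ?ler0n //; case: (hS l) => -[].
case/mxvec_indexP: y => k l; rewrite sum_mxvec_index exchange_big /=.
rewrite (bigD1 l) //= [X in _ + X]big1 ?addr0.
  under eq_bigr do rewrite NE eqxx mulr1.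
  by case: (hS l) => -[].
by move=> j /negbTE njl; apply: big1 => i _; rewrite NE njl mulr0.
Qed.

(** The other rounds stay idle, the identity being itself a one-round map. *)
Lemma one_round_LTOCC (R : realType) (dA dB : nat) (gA : 'cV[R]_dA)
    (gB : 'cV[R]_dB) (n : nat) (N : 'M[R]_(dA * dB)) : (0 < n)%N ->
  one_round gA gB N -> LTOCC gA gB n N.
Proof.
case: n => // n _ hN; exists (fun r => if r == ord0 then N else 1%:M); split.
  move=> r; case: eqP => // _.
  apply: (@one_round_Bob _ _ _ _ _ (fun=> 1%:M)) => [k|i j k l]; first exact: thermal_op1.
  by rewrite !mxE mxvec_index_inj -natrM mulnb.
rewrite big_ord_recl eqxx; set P := \big[_/_]_(i < _) _.
suff -> : P = 1%:M by rewrite mulmx1.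
by apply: (big_rec (fun X => X = 1%:M)) => // i X _ ->; rewrite mulmx1.
Qed.

Lemma LTOCC_sub_SR (R : realType) (dA dB : nat) (gA : 'cV[R]_dA)
    (gB : 'cV[R]_dB) (n : nat) : LTOCC gA gB n `<=` LTOCC_SR gA gB n.
Proof.
move=> M hM; exists 1%N, (fun=> 1), (fun=> M).
by split=> //; rewrite big_ord1 ?scale1r.
Qed.

Lemma LTOCC_SR_midpoint (R : realType) (dA dB : nat) (gA : 'cV[R]_dA)
    (gB : 'cV[R]_dB) (n : nat) (N N' : 'M[R]_(dA * dB)) :
  LTOCC gA gB n N -> LTOCC gA gB n N' ->
  LTOCC_SR gA gB n ((1 / 2) *: N + (1 / 2) *: N').
Proof.
move=> hN hN'; exists 2%N, (fun=> 1 / 2), (fun a => if a == ord0 then N else N').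
split=> [_||a|]; first lra.
- by rewrite !big_ord_recl big_ord0; lra.
- by case: ifP.
- by rewrite !big_ord_recl big_ord0 /= addr0.
Qed.

(** * The cross in the product grid *)

Definition cross_leaves (m n : nat) (k0 : 'I_m) (l0 : 'I_n) : {set 'I_(m * n)} :=
  imset (fun l => mxvec_index k0 l) (mem (predC1 l0)) :|:
  imset (fun k => mxvec_index k l0) (mem (predC1 k0)).

Lemma mem_cross_leaves (m n : nat) (k0 k : 'I_m) (l0 l : 'I_n) :
  (mxvec_index k l \in cross_leaves k0 l0) = (k == k0) (+) (l == l0).
Proof.
rewrite inE; apply/orP/idP => [[] /imsetP[z]|].
- rewrite !inE => nz /eqP; rewrite mxvec_index_inj => /andP[/eqP-> /eqP->].
  by rewrite eqxx (negbTE nz).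
- rewrite !inE => nz /eqP; rewrite mxvec_index_inj => /andP[/eqP-> /eqP->].
  by rewrite eqxx (negbTE nz).
case: (eqVneq k k0) => [->|nk] /=.
  by move=> nl; left; apply/imsetP; exists l; rewrite ?inE.
by move=> /eqP->; right; apply/imsetP; exists k; rewrite ?inE.
Qed.

(** The two arms are disjoint. For [m, n >= 2] the count is at least 2, [m] and [n], as [star] and
    [one_round_not_star] ask. *)
Lemma card_cross_leaves (m n : nat) (k0 : 'I_m) (l0 : 'I_n) :
  #|cross_leaves k0 l0| = (n.-1 + m.-1)%N.
Proof.
rewrite cardsU.
have -> : imset (fun l => mxvec_index k0 l) (mem (predC1 l0)) :&:
  imset (fun k => mxvec_index k l0) (mem (predC1 k0)) = finset.set0.
  apply/eqP; rewrite -finset.subset0; apply/fintype.subsetP => x; rewrite inE.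
  move=> /andP[/imsetP[l + ->] /imsetP[k + /eqP]]; rewrite !inE mxvec_index_inj.
  by move=> /negbTE nl _ /andP[_]; rewrite nl.
rewrite cards0 subn0 !card_imset ?cardC1 ?card_ord //.
- by move=> k k' /eqP; rewrite mxvec_index_inj => /andP[/eqP].
- by move=> l l' /eqP; rewrite mxvec_index_inj => /andP[_ /eqP].
Qed.

(** * Choice of the rates and strictness of the inclusion *)

Lemma exists_small_multiples (R : realType) (delta x y : R) :
  0 < delta -> 0 <= x -> 0 <= y ->
  exists eps, [/\ 0 < eps, eps <= delta, x * eps < 1 / 2 & y * eps < 1 / 2].
Proof.
move=> delta_gt0 x0 y0; have D_gt0 : 0 < 4 * (1 + x + y) by lra.
exists (Order.min delta 1 / (4 * (1 + x + y))).
have m_gt0 : 0 < Order.min delta 1 by rewrite lt_min delta_gt0 ltr01.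
have m_le1 : Order.min delta 1 <= 1 by rewrite ge_min lexx orbT.
have m_le : Order.min delta 1 <= delta by rewrite ge_min lexx.
split; first by rewrite divr_gt0.
- rewrite ler_pdivrMr //; apply: le_trans m_le _.
  by rewrite ler_peMr ?ltW //; lra.
- by rewrite mulrA ltr_pdivrMr //; nra.
- by rewrite mulrA ltr_pdivrMr //; nra.
Qed.

Theorem theorem6 (R : realType) (dA dB : nat) (hdA : (2 <= dA)%N)
    (hdB : (2 <= dB)%N) (betaA betaB : R) (EA : 'I_dA -> R) (EB : 'I_dB -> R)
    (n : nat) (hn : (1 <= n)%N) :
  LTOCC (gibbs betaA EA) (gibbs betaB EB) n `<`
  LTOCC_SR (gibbs betaA EA) (gibbs betaB EB) n.
Proof.
have gA_gt0 := gibbs_gt0 betaA EA; have gB_gt0 := gibbs_gt0 betaB EB.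
move: (gibbs betaA EA) (gibbs betaB EB) gA_gt0 gB_gt0 => gA gB gA_gt0 gB_gt0.
split; first exact: LTOCC_sub_SR.
have [k0 k0_min] := exists_argmin gA (ltnW hdA).
have [l0 l0_min] := exists_argmin gB (ltnW hdB).
pose g := joint_gibbs gA gB; pose o := mxvec_index k0 l0.
have g_gt0 y : 0 < g y 0.
  by case/mxvec_indexP: y => k l; rewrite joint_gibbsE mulr_gt0.
have g_min y : g o 0 <= g y 0.
  by case/mxvec_indexP: y => k l; rewrite !joint_gibbsE ler_pM // ltW.
(* [delta] lies below every positive value of [1 - g b / g y], the rates to be avoided. *)
have [delta delta_gt0 gap] := exists_lower_bound
  (fun p : 'I_(dA * dB) * 'I_(dA * dB) => (g p.2 0 - g p.1 0) / g p.2 0).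
have [eps [eps_gt0 eps_delta epsA epsB]] :=
  exists_small_multiples delta_gt0 (ler0n R dA) (ler0n R dB).
have [SA [SAg SA_diag SA_off SA_supp]] := star_thermal_op gA_gt0 k0_min eps_gt0 epsA.
have [SB [SBg SB_diag SB_off SB_supp]] := star_thermal_op gB_gt0 l0_min eps_gt0 epsB.
(* [N1] applies [SB] on Bob's side when Alice is in [k0]; [N2] applies [SA] on Alice's side when Bob
   is in [l0]. *)
have [N1 N1E] := exists_mxvec_matrix
  (fun i j k l => (i == k)%:R * (if k == k0 then SB else 1%:M) j l).
have [N2 N2E] := exists_mxvec_matrix
  (fun i j k l => (if l == l0 then SA else 1%:M) i k * (j == l)%:R).
have r1 : one_round gA gB N1.
  apply: (@one_round_Bob _ _ _ _ _ (fun k => if k == k0 then SB else 1%:M)) => // k.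
  by case: ifP => _ //; exact: thermal_op1.
have r2 : one_round gA gB N2.
  apply: (@one_round_Alice _ _ _ _ _ (fun l => if l == l0 then SA else 1%:M)) => // l.
  by case: ifP => _ //; exact: thermal_op1.
pose M := (1 / 2) *: N1 + (1 / 2) *: N2.
have ME x y : M x y = (N1 x y + N2 x y) / 2 by rewrite !mxE; lra.
have N1_ge0 := r1.1.1; have N2_ge0 := r2.1.1.
have id_gt0 d (i j : 'I_d) : (0 < (1%:M : 'M[R]_d) i j) = (i == j).
  by rewrite mxE ltr0n lt0b.
have supp1 i j k l : (0 < N1 (mxvec_index i j) (mxvec_index k l)) =
    (i == k) && ((j == l) || (k == k0) && ((j == l0) || (l == l0))).
  rewrite N1E; case: (i == k); rewrite ?mul0r ?ltxx // mul1r.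
  by case: (k == k0); rewrite ?SB_supp ?id_gt0 ?orbF.
have supp2 i j k l : (0 < N2 (mxvec_index i j) (mxvec_index k l)) =
    (j == l) && ((i == k) || (l == l0) && ((i == k0) || (k == k0))).
  rewrite N2E; case: (j == l); rewrite ?mulr0 ?ltxx // mulr1.
  by case: (l == l0); rewrite ?SA_supp ?id_gt0 ?orbF.
pose leaf := cross_leaves k0 l0.
have M_star : star o leaf M.
  split=> [||x|x y].
  - by rewrite mem_cross_leaves !eqxx.
  - by rewrite card_cross_leaves; lia.
  - rewrite ME; case/mxvec_indexP: x => k l; rewrite N1E N2E !eqxx !mulr1n [X in X + _]mul1r mulr1.
    have h1 : 1 / 2 < (if k == k0 then SB else 1%:M) l l.
      by case: ifP => _ //; rewrite mxE eqxx mulr1n; lra.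
    have h2 : 1 / 2 < (if l == l0 then SA else 1%:M) k k.
      by case: ifP => _ //; rewrite mxE eqxx mulr1n; lra.
    lra.
  - have -> : (0 < M x y) = (0 < N1 x y) || (0 < N2 x y).
      rewrite ME; move: (N1_ge0 x y) (N2_ge0 x y) => h1 h2.
      apply/idP/orP => [h|[]]; [|lra|lra].
      by case: (ltP 0 (N1 x y)) => h1'; [left | right; lra].
    case/mxvec_indexP: x => i j; case/mxvec_indexP: y => k l.
    rewrite supp1 supp2 !mxvec_index_inj !mem_cross_leaves.
    (* Transitivity of equality rules out the inconsistent Boolean cases. *)
    have eqs d (a b c : 'I_d) : if a == b then (a == c) == (b == c)
        else ~~ ((a == c) && (b == c)).
      case: (eqVneq a b) => [->|nab]; first by rewrite eqxx.
      by apply: contraNN nab => /andP[/eqP-> /eqP->].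
    move: (eqs _ i k k0) (eqs _ j l l0).
    by case: (i == k); case: (j == l); case: (i == k0); case: (k == k0);
      case: (j == l0); case: (l == l0).
have res b y : b \in leaf -> M o b * g y 0 != g y 0 - g b 0.
  move=> bl; apply/eqP => E.
  have Mob_gt0 : 0 < M o b by case: M_star => _ _ _ ->; rewrite eqxx bl !orbT.
  (* A leaf lies on one arm only, so just one of [N1], [N2] contributes, with weight 1/2. *)
  have Mob_le : M o b <= eps / 2.
    move: bl; rewrite ME; case/mxvec_indexP: b {E Mob_gt0} => k l.
    rewrite mem_cross_leaves N1E N2E.
    case: (eqVneq k k0) => [->|nk] /=.
      move=> nl; rewrite (eq_sym l0 l) (negbTE nl) mulr0 addr0 [X in X / 2]mul1r.
      by rewrite ler_pM2r ?SB_off // 1?eq_sym //; lra.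
    move=> /eqP->; rewrite !eqxx mulr1 mul0r add0r.
    by rewrite ler_pM2r ?SA_off // 1?eq_sym //; lra.
  have gn0 : g y 0 != 0 by rewrite gt_eqF.
  (* Equality would make [M o b] one of the positive values bounded by [delta], yet
     [M o b <= eps / 2 < delta]. *)
  have := gap (b, y) => /=; rewrite -E mulfK // => /(_ Mob_gt0).
  lra.
(* If the mixture [M] were a product of [n] rounds, one round would be [M] with rows and columns
   permuted. *)
move=> /(_ M (LTOCC_SR_midpoint (one_round_LTOCC hn r1) (one_round_LTOCC hn r2))).
case=> N [hN MN].
have [|||N0 [t [u [/mapP[r _ ->] NE]]]] :=
  star_factor_prod (s := [seq N r | r <- index_enum _]) (p := 1%g) M_star g_gt0 g_min res.
- by move=> N' /mapP[r _ ->]; apply: one_round_thermal.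
- by rewrite perm_mx1; exact: thermal_op1.
- by rewrite perm_mx1 mul1mx big_map.
apply: (one_round_not_star (gA := gA) (gB := gB) (t := t) (u := u) M_star).
- by rewrite card_cross_leaves; lia.
- by rewrite card_cross_leaves; lia.
by rewrite -NE.
Qed.
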